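(* Let $\mathcal H$ be a real separable Hilbert space, let $T:\mathcal H\to\mathcal H$ be $\alpha$-averaged for some $\alpha\in(0,1]$ with $\operatorname{fix}T\neq\emptyset$, and let $R=\mathrm{id}-T$. Consider the iterates $(x_k)_{k\in\mathbb N}$ generated by the General Framework (described in the context), and suppose that for all $k$ it is always possible to find a point $x_{k+1}$ complying with the requirements of either step 2, step 3(a) or step 3(b), and further satisfying, for some constant $D\ge 0$, $$\|x_{k+1}-x_k\|\le D\|Rx_k\|\qquad\forall k\in K_0\cup K_1 .$$ Then: (i) $(x_k)_{k\in\mathbb N}$ is quasi-Fejér monotone with respect to $\operatorname{fix}T$; (ii) $Rx_k\to0$, with $\sum_{k\in\mathbb N}\|Rx_k\|^2<\infty$; (iii) $(x_k)_{k\in\mathbb N}$ converges weakly to a point $x_\star\in\operatorname{fix}T$; (iv) if $c_0>0$, the number of blind updates (step 2) is infinite, i.e. $K_0$ is infinite.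
   Context: An operator $T$ is nonexpansive if $\|Tx-Ty\|\le\|x-y\|$ for all $x,y\in\mathcal H$; it is $\alpha$-averaged, $\alpha\in(0,1)$, if $T=(1-\alpha)\mathrm{id}+\alpha S$ for some nonexpansive $S:\mathcal H\to\mathcal H$; $1$-averaged means nonexpansive. $\operatorname{fix}T=\{z: Tz=z\}$. Quasi-Fejér monotone with respect to a nonempty set $S$: for every $s\in S$ there is a summable sequence of positive numbers $(\varepsilon_k(s))_{k}$ such that $\|x_{k+1}-s\|^2\le\|x_k-s\|^2+\varepsilon_k(s)$ for all $k\in\mathbb N$. General Framework. Parameters: $x_0\in\mathcal H$, $c_0,c_1,q\in[0,1)$, $\sigma>0$. Initialize $\eta_0=r_{\rm safe}=\|Rx_0\|$, $k=0$. Step 1. If $Rx_k=0$, stop. Step 2 (blind update). If $\|Rx_k\|\le c_0\eta_k$, set $\eta_{k+1}=\|Rx_k\|$, choose $x_{k+1}$ arbitrarily, and go to step 4. Step 3. Otherwise set $\eta_{k+1}=\eta_k$ and select $x_{k+1}$ such that (a) (educated update) either the safe condition $\|Rx_k\|\le r_{\rm safe}$ holds and $\|Rx_{k+1}\|\le c_1\|Rx_k\|$, in which case update $r_{\rm safe}=\|Rx_{k+1}\|+q^k$; (b) (safeguard update) or $\|x_{k+1}-z\|^2\le\|x_k-z\|^2-\sigma\|Rx_k\|^2$ for all $z\in\operatorname{fix}T$. Step 4. Set $k\gets k+1$ and go to step 1. $K_0,K_1,K_2\subseteq\mathbb N$ denote the sets of iteration indices $k$ at which $x_{k+1}$ is produced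 by step 2, 3(a), 3(b) respectively. Standing assumption: a solution is not found in finitely many steps, i.e. $Rx_k\ne0$ for all $k$, so infinitely many iterates are generated. *)

(* Defs.v *)
From HB Require Import structures.
From mathcomp Require Import all_boot all_order all_algebra.
From mathcomp Require Import all_classical all_reals all_analysis.

Set Implicit Arguments.
Unset Strict Implicit.
Unset Printing Implicit Defensive.

Import Order.TTheory GRing.Theory Num.Theory.
Import numFieldNormedType.Exports.

Local Open Scope classical_set_scope.
Local Open Scope ring_scope.

(* A real Hilbert space is given by a complete normed space [H] over a
   [realType] together with a positive definite symmetric bilinear form
   [dot : {dot H for idfun}] that induces the norm of [H]. *)
Definition induces_norm (R : realType) (H : completeNormedModType R)
    (dot : {dot H for idfun}) : Prop :=
  forall v : H, `|v| = Num.sqrt (dot v v).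

Definition separable (X : topologicalType) : Prop :=
  exists2 D : set X, countable D & dense D.

Definition weakly_cvg (R : realType) (H : completeNormedModType R)
    (dot : {dot H for idfun}) (x : nat -> H) (l : H) : Prop :=
  forall y : H, dot (x k) y @[k --> \oo] --> (dot l y : R).

Section Operators.
Variables (R : realType) (H : completeNormedModType R).
Implicit Types (T : H -> H) (x : nat -> H).

Definition nonexpansive T : Prop := forall x y : H, `|T x - T y| <= `|x - y|.

(* Used for [0 < alpha <= 1]; see [averaged1] for the case [alpha = 1]. *)
Definition averaged (alpha : R) T : Prop :=
  exists2 S : H -> H, nonexpansive S &
    forall x : H, T x = (1 - alpha) *: x + alpha *: S x.

Lemma averaged1 T : averaged 1 T <-> nonexpansive T.
Proof.
split=> [[S neS TE] x y|neT].
  by rewrite !TE subrr !scale0r !add0r !scale1r; exact: neS.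
by exists T => // x; rewrite subrr scale0r add0r scale1r.
Qed.

Definition fixpoints T : set H := [set z | T z = z].

Definition residual T (x : H) : H := x - T x.

Definition quasi_fejer x (S : set H) : Prop :=
  forall s : H, S s -> exists eps : nat -> R,
    [/\ forall k, 0 < eps k,
        cvgn (series eps) &
        forall k, `|x k.+1 - s| ^+ 2 <= `|x k - s| ^+ 2 + eps k].

End Operators.

Inductive update := Blind | Educated | Safeguard.

(* Indices [k] at which [x k.+1] is produced by an update of kind [c]:
   K_0, K_1, K_2 for [c] = [Blind], [Educated], [Safeguard]. *)
Definition iterations (u : nat -> update) (c : update) : set nat :=
  [set k | u k = c].

(* One pass through steps 2-4 at iteration [k], from the current iterate [x],
   [eta], [r_safe] to the primed values. A blind update is performed if and only
   if its test succeeds; between the other two the choice is free whenever both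
   are admissible. *)
Definition framework_step (R : realType) (H : completeNormedModType R)
    (T : H -> H) (c0 c1 q sigma : R) (k : nat) (c : update)
    (x : H) (eta rsafe : R) (x' : H) (eta' rsafe' : R) : Prop :=
  match c with
  | Blind =>
      [/\ `|residual T x| <= c0 * eta,
          eta' = `|residual T x| &
          rsafe' = rsafe]
  | Educated =>
      [/\ c0 * eta < `|residual T x|,
          eta' = eta,
          `|residual T x| <= rsafe,
          `|residual T x'| <= c1 * `|residual T x| &
          rsafe' = `|residual T x'| + q ^+ k]
  | Safeguard =>
      [/\ c0 * eta < `|residual T x|,
          eta' = eta,
          rsafe' = rsafe &
          forall z : H, fixpoints T z ->
            `|x' - z| ^+ 2 <= `|x - z| ^+ 2 - sigma * `|residual T x| ^+ 2]
  end.

(* An infinite run: the stopping test of step 1 never succeeds, [u k] is the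
   kind of update performed at iteration [k], and [eta k], [rsafe k] are the
   values of the two parameters on entry to iteration [k]. *)
Record general_framework (R : realType) (H : completeNormedModType R)
    (T : H -> H) (c0 c1 q sigma : R)
    (x : nat -> H) (eta rsafe : nat -> R) (u : nat -> update) : Prop := {
  framework_eta0 : eta 0%N = `|residual T (x 0%N)|;
  framework_rsafe0 : rsafe 0%N = `|residual T (x 0%N)|;
  framework_continue : forall k, residual T (x k) <> 0;
  framework_update : forall k,
    framework_step T c0 c1 q sigma k (u k)
      (x k) (eta k) (rsafe k) (x k.+1) (eta k.+1) (rsafe k.+1)
}.

(* Main.v *)
Require Import Defs.
From HB Require Import structures.
From mathcomp Require Import all_boot all_order all_algebra.
From mathcomp Require Import all_classical all_reals all_analysis.
From mathcomp Require Import ring lra.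

Set Implicit Arguments.
Unset Strict Implicit.
Unset Printing Implicit Defensive.

Import Order.TTheory GRing.Theory Num.Theory.
Import numFieldNormedType.Exports.

Local Open Scope classical_set_scope.
Local Open Scope ring_scope.

(** Call a step unguarded if it is blind or educated.  Along the run the
potential [c0 / (1 - c0) * eta k + rsafe k / (1 - c1)] drops by at least the
current residual at each unguarded step, up to a geometric error, because
[eta] contracts by [c0] at blind steps and [rsafe] by [c1], up to [q ^+ k], at
educated ones.  Hence the residuals at unguarded steps are summable
([unguarded_residual_summable]).  Such a step moves the iterate by at most [D]
times the residual, whereas a safeguarded step comes no farther from any fixed
point; so distances to a fixed point [z] increase by summable amounts only.
They therefore converge ([dist_fixpoint_cvg]) and are bounded, which turns the
estimate on distances into one on their squares: quasi-Fejer monotonicity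
([framework_quasi_fejer]).  The descent condition at safeguarded steps, and the
bound [`|residual T y| <= 2 * `|y - z|] at the others, make the squared distance
to [z] a potential for the squared residuals ([sqr_residual_summable]).  If only
finitely many steps were blind, [eta] would be eventually constant and positive,
and the residuals would stay above [c0] times that constant
([infinite_blind]).

Weak convergence ([weak_cvg_fixpoint]) is obtained from asymptotic centers
instead of weak compactness.  The asymptotic center of a bounded family along a
filter is the point that minimizes the upper limit of the distances to the
family; it exists and is unique by the parallelogram law and completeness.  When
[T] is nonexpansive and the residuals tend to 0, applying [T] to a center gives
another one, so the center is a fixed point.  Let [p] be the center of the
whole sequence.  Since distances to fixed points converge, a fixed point has the
same upper limit of distances along every finer filter [G]; the center along [G]
being a fixed point as well, [p] is also the center along [G].  Were
[dot (x k - p) y >= e > 0] for infinitely many [k], then along the filter of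
those indices a small multiple of [y] added to [p] would give a strictly smaller
upper limit ([asymptotic_center_dot]), which is absurd. *)

(** * Inner products *)

Section InnerProduct.
Variables (R : realType) (H : completeNormedModType R).
Variables (dot : {dot H for idfun}) (hdot : induces_norm dot).
Implicit Types u v : H.

Lemma sqr_normE v : `|v| ^+ 2 = dot v v.
Proof.
have [->|v0] := eqVneq v 0; first by rewrite normr0 expr0n linear0l.
by rewrite hdot sqr_sqrtr// ltW// neq0_dnorm_gt0.
Qed.

Lemma sqr_normD u v :
  `|u + v| ^+ 2 = `|u| ^+ 2 + 2 * dot u v + `|v| ^+ 2.
Proof.
rewrite !sqr_normE linearDl/= !linearDr/=.
have -> : dot v u = dot u v by rewrite (hermC dot) expr0 mul1r.
by lra.
Qed.

(** The parallelogram law, arranged to bound distances to a midpoint. *)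
Lemma sqr_norm_midpoint w u v :
  `|w - 2^-1 *: (u + v)| ^+ 2 =
  2^-1 * `|w - u| ^+ 2 + 2^-1 * `|w - v| ^+ 2 - 4^-1 * `|u - v| ^+ 2.
Proof.
have -> : w - 2^-1 *: (u + v) = 2^-1 *: ((w - u) + (w - v)).
  rewrite addrACA -opprD scalerBr -mulr2n -(scaler_nat 2 w) scalerA.
  by rewrite mulVf ?scale1r// pnatr_eq0.
have -> : u - v = (w - v) - (w - u) by rewrite opprB [RHS]addrC subrKA.
move: (w - u) (w - v) => a b.
rewrite normrZ exprMn ger0_norm// !sqr_normD normrN linearNr/=.
by rewrite (hermC dot b a) expr0 mul1r/=; lra.
Qed.

End InnerProduct.

(** * Asymptotic centers along a filter *)

Section AsymptoticCenter.
Variables (R : realType) (H : completeNormedModType R).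
Variables (dot : {dot H for idfun}) (hdot : induces_norm dot).
Variables (I : Type) (F : set_system I) (FF : ProperFilter F) (x : I -> H).
Implicit Types (y p : H) (r : R).

Definition eventually_within y r : Prop := \forall i \near F, `|x i - y| <= r.

(** The infimum over [y] of the upper limit of [`|x i - y|] along [F]; the
bound [r] ranges over what is eventually an upper bound, so that no upper limit
has to be formed. *)
Definition asymptotic_radius : R := inf [set r | exists y, eventually_within y r].

(** Equivalently, the upper limit of [`|x i - p|] along [F] is at most the
asymptotic radius. *)
Definition asymptotic_center p : Prop :=
  forall r, asymptotic_radius < r -> eventually_within p r.

Lemma eventually_within_ge0 y r : eventually_within y r -> 0 <= r.
Proof. by move=> /filter_ex[i]; exact: le_trans. Qed.

Lemma eventually_within_trans y y' r :
  eventually_within y r -> eventually_within y' (r + `|y - y'|).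
Proof.
apply: filterS => i xy; rewrite -(subrKA y).
by apply: le_trans (ler_normD _ _) _; rewrite lerD2r.
Qed.

Lemma eventually_within_le y r r' :
  r <= r' -> eventually_within y r -> eventually_within y r'.
Proof. by move=> rr'; apply: filterS => i /le_trans; apply. Qed.

Lemma asymptotic_radius_le y r : eventually_within y r -> asymptotic_radius <= r.
Proof.
move=> yr; apply: ge_inf; last by exists y.
by exists 0 => s [z /eventually_within_ge0].
Qed.

Lemma asymptotic_radius_ge0 y r : eventually_within y r -> 0 <= asymptotic_radius.
Proof.
move=> yr; apply: lb_le_inf; first by exists r; exists y.
by move=> s [z /eventually_within_ge0].
Qed.

(** The family is eventually within [r] of [y] and of [y'], hence within
[Num.sqrt (r ^+ 2 - `|y - y'| ^+ 2 / 4)] of their midpoint, and this cannot be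
below the asymptotic radius.  Existence and uniqueness of centers both rest on
this estimate. *)
Lemma eventually_within_dist y y' r :
  eventually_within y r -> eventually_within y' r ->
  `|y - y'| ^+ 2 <= 4 * (r ^+ 2 - asymptotic_radius ^+ 2).
Proof.
move=> yr y'r; have rad0 := asymptotic_radius_ge0 yr; pose m := 2^-1 *: (y + y').
pose s := r ^+ 2 - 4^-1 * `|y - y'| ^+ 2.
have r0 := eventually_within_ge0 yr.
have near_m : \forall i \near F, `|x i - m| ^+ 2 <= s.
  near=> i; rewrite (sqr_norm_midpoint hdot) /s.
  have : `|x i - y| ^+ 2 <= r ^+ 2.
    by rewrite ler_pXn2r ?nnegrE//; near: i.
  have : `|x i - y'| ^+ 2 <= r ^+ 2.
    by rewrite ler_pXn2r ?nnegrE//; near: i.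
  by lra.
have s0 : 0 <= s by have [i] := filter_ex near_m; apply: le_trans; exact: sqr_ge0.
have : asymptotic_radius <= Num.sqrt s.
  apply: (@asymptotic_radius_le m); apply: filterS near_m => i.
  by move=> /ler_wsqrtr; rewrite sqrtr_sqr normr_id.
rewrite -(ler_pXn2r (ltn0Sn 1)) ?nnegrE ?sqrtr_ge0// sqr_sqrtr// /s.
by lra.
Unshelve. all: by end_near. Qed.

Hypothesis bounded_x : exists y r, eventually_within y r.

Lemma asymptotic_radius_lt r :
  asymptotic_radius < r -> exists y, eventually_within y r.
Proof.
move=> rad_r; have [y0 [r0 y0r0]] := bounded_x.
have [||s [y ys]] := @inf_adherent _ [set r | exists y, eventually_within y r]
  (r - asymptotic_radius); first by rewrite subr_gt0.
  split; first by exists r0; exists y0.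
  by exists 0 => s [z /eventually_within_ge0].
rewrite addrC subrK => /ltW sr; exists y; exact: eventually_within_le sr ys.
Qed.

(** Supplies the [r] for which [eventually_within_dist] confines near-optimal
points to a set of prescribed small diameter. *)
Lemma asymptotic_radius_approx e : 0 < e ->
  exists2 r, asymptotic_radius < r & 4 * (r ^+ 2 - asymptotic_radius ^+ 2) < e.
Proof.
move=> e0; have [y [r /asymptotic_radius_ge0]] := bounded_x.
set a := asymptotic_radius => a0.
have d0 : 0 < e + 4 * (2 * a + 1) by lra.
(* For [0 < t < 1], [(a + t) ^+ 2 - a ^+ 2 < t * (2 * a + 1)]; the extra [e] in
   the denominator ensures [t < 1]. *)
pose t := e / (e + 4 * (2 * a + 1)).
have t0 : 0 < t by exact: divr_gt0.
have t1 : t < 1 by rewrite ltr_pdivrMr// mul1r; lra.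
have tE : t * (e + 4 * (2 * a + 1)) = e by rewrite divfK// gt_eqF.
exists (a + t); first by lra.
nra.
Qed.

(** The sets of points that the family is eventually within [r] of, for [r]
above the asymptotic radius, are nested with diameters tending to 0; they
generate a Cauchy filter, whose limit is the center. *)
Lemma asymptotic_center_exists : exists p, asymptotic_center p.
Proof.
pose B r := [set y | eventually_within y r].
pose G := filter_from [set r | asymptotic_radius < r] B.
have GF : ProperFilter G.
  apply: filter_from_proper; last by move=> r; exact: asymptotic_radius_lt.
  apply: filter_from_filter.
    by exists (asymptotic_radius + 1) => /=; rewrite ltrDl.
  move=> r s /= radr rads; exists (Num.min r s); first by rewrite /= lt_min radr.
  move=> y yrs; split; apply: eventually_within_le yrs.
    by rewrite ge_min lexx.
  by rewrite ge_min lexx orbT.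
have /cauchy_cvgP cvgG : cauchy G.
  apply: cauchy_exP => e e0.
  have [|r radr re] := @asymptotic_radius_approx (e ^+ 2).
    by rewrite exprn_gt0.
  have [y yr] := asymptotic_radius_lt radr; exists y; exists r => //= y' y'r.
  rewrite -ball_normE/= -(ltr_pXn2r (ltn0Sn 1)) ?nnegrE// ?ltW//.
  by apply: le_lt_trans re; exact: eventually_within_dist.
exists (lim G) => r radr; pose d := (r - asymptotic_radius) / 2.
have d0 : 0 < d by rewrite divr_gt0// subr_gt0.
have near_ball : G (ball (lim G) d) by apply: cvgG; exact: nbhsx_ballx.
have near_B : G (B (r - d)) by exists (r - d) => //=; rewrite /d; lra.
have [y [yd yr]] := filter_ex (filterI near_ball near_B).
apply: eventually_within_le (eventually_within_trans (lim G) yr).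
move: yd; rewrite -ball_normE/= distrC => /ltW; lra.
Qed.

Lemma asymptotic_center_unique p p' :
  asymptotic_center p -> asymptotic_center p' -> p = p'.
Proof.
move=> cp cp'; apply/eqP; rewrite -subr_eq0 -normr_le0 leNgt; apply/negP => d0.
have [|r radr] := @asymptotic_radius_approx (`|p - p'| ^+ 2).
  by rewrite exprn_gt0.
apply/negP; rewrite -leNgt.
by apply: eventually_within_dist; [exact: cp|exact: cp'].
Qed.

(** Otherwise moving [p] by a small multiple of [y] brings it closer to the
family.  The step [e / `|y| ^+ 2] is the minimizer of
[- 2 * t * e + t ^+ 2 * `|y| ^+ 2], which bounds the change of the squared
distance. *)
Lemma asymptotic_center_dot p y e : asymptotic_center p -> 0 < e ->
  ~ \forall i \near F, e <= dot (x i - p) y.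
Proof.
move=> cp e0 near_e.
have y0 : 0 < `|y| ^+ 2.
  rewrite exprn_gt0// normr_gt0; apply/eqP => yE.
  have [i] := filter_ex near_e.
  by rewrite yE linear0r leNgt e0.
pose t := e / `|y| ^+ 2.
have tE : t * `|y| ^+ 2 = e by rewrite divfK// gt_eqF.
have t0 : 0 < t by exact: divr_gt0.
have te0 : 0 < t * e by exact: mulr_gt0.
have [|r radr re] := @asymptotic_radius_approx (4 * (t * e)); first by rewrite mulr_gt0.
have r0 := eventually_within_ge0 (cp _ radr).
pose s := r ^+ 2 - t * e.
have near_s : \forall i \near F, `|x i - (p + t *: y)| ^+ 2 <= s.
  near=> i; rewrite opprD addrA (sqr_normD hdot) linearNr linearZr_LR/= normrN.
  rewrite normrZ exprMn (ger0_norm (ltW t0)).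
  have : e <= dot (x i - p) y by near: i.
  rewrite -(ler_pM2l t0).
  have : `|x i - p| ^+ 2 <= r ^+ 2.
    by rewrite ler_pXn2r ?nnegrE//; near: i; exact: cp.
  have -> : t ^+ 2 * `|y| ^+ 2 = t * e by rewrite -tE; ring.
  by rewrite /s; lra.
have s0 : 0 <= s by have [i] := filter_ex near_s; apply: le_trans; exact: sqr_ge0.
have rad_s : asymptotic_radius <= Num.sqrt s.
  apply: (@asymptotic_radius_le (p + t *: y)); apply: filterS near_s => i.
  by move=> /ler_wsqrtr; rewrite sqrtr_sqr normr_id.
move: rad_s; rewrite -(ler_pXn2r (ltn0Sn 1)) ?nnegrE ?sqrtr_ge0//.
  by rewrite sqr_sqrtr// /s; lra.
exact: asymptotic_radius_ge0 (cp _ radr).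
Unshelve. all: by end_near. Qed.

Lemma asymptotic_radius_le_lim y l :
  `|x i - y| @[i --> F] --> l -> asymptotic_radius <= l.
Proof.
move=> yl; apply/ler_addgt0Pr => e e0; apply: (@asymptotic_radius_le y).
move/cvgrPdist_le/(_ _ e0): yl; apply: filterS => i.
by rewrite ler_norml; lra.
Qed.

Lemma asymptotic_center_lim_le p l :
  `|x i - p| @[i --> F] --> l -> asymptotic_center p -> l <= asymptotic_radius.
Proof.
move=> pl cp; apply/ler_addgt0Pr => e e0.
by apply: cvgr_to_le pl _; apply: cp; rewrite ltrDl.
Qed.

Lemma asymptotic_center_of_lim p l :
  `|x i - p| @[i --> F] --> l -> l <= asymptotic_radius -> asymptotic_center p.
Proof.
move=> pl lrad r radr; have lr : 0 < r - l by lra.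
move/cvgrPdist_le/(_ _ lr): pl; apply: filterS => i.
by rewrite ler_norml; lra.
Qed.

(** [T p] is at most as far from [T (x i)] as [p] is from [x i], and [x i] is
asymptotic to [T (x i)]; so [T p] is again a center. *)
Lemma asymptotic_center_fixed (T : H -> H) p : nonexpansive T ->
  residual T (x i) @[i --> F] --> (0 : H) -> asymptotic_center p -> T p = p.
Proof.
move=> neT res0 cp; apply: asymptotic_center_unique => // r radr.
pose d := (r - asymptotic_radius) / 2.
have d0 : 0 < d by rewrite divr_gt0// subr_gt0.
have : eventually_within p (r - d) by apply: cp; rewrite /d; lra.
move=> pr; near=> i.
have -> : x i - T p = residual T (x i) + (T (x i) - T p).
  by rewrite /residual subrKA.
apply: le_trans (ler_normD _ _) _.
have : `|residual T (x i)| <= d by near: i; move/cvgr0Pnorm_le: res0; exact.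
have : `|x i - p| <= r - d by near: i.
by have := neT (x i) p; lra.
Unshelve. all: by end_near. Qed.

End AsymptoticCenter.

(** * Weak convergence to a fixed point *)

Section WeakConvergence.
Variables (R : realType) (H : completeNormedModType R).
Variables (dot : {dot H for idfun}) (hdot : induces_norm dot).

(** A form of Opial's lemma in which the asymptotic center plays the role of the
weak cluster points. *)
Lemma weak_cvg_fixpoint (T : H -> H) (x : nat -> H) :
  nonexpansive T -> fixpoints T !=set0 ->
  residual T (x k) @[k --> \oo] --> (0 : H) ->
  (forall z, fixpoints T z -> cvgn (fun k => `|x k - z|)) ->
  exists2 p, fixpoints T p & weakly_cvg dot x p.
Proof.
move=> neT [z fz] res0 cvg_dist.
have dist_lim y G : Filter G -> G --> \oo -> fixpoints T y ->
    `|x k - y| @[k --> G] --> limn (fun k => `|x k - y|).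
  by move=> FG G_oo fy; apply: cvg_trans (cvg_dist _ fy); exact: cvg_app.
have center_fixpoint G : ProperFilter G -> G --> \oo ->
    exists2 p, fixpoints T p & asymptotic_center G x p.
  move=> PG G_oo.
  have bnd : exists y r, eventually_within G x y r.
    exists z, (limn (fun k => `|x k - z|) + 1).
    have /cvgrPdist_le/(_ _ ltr01) := dist_lim z G PG G_oo fz; apply: filterS => k.
    by rewrite ler_norml; lra.
  have [p cp] := asymptotic_center_exists hdot PG bnd.
  exists p => //; apply: (asymptotic_center_fixed hdot PG bnd neT) cp.
  by apply: cvg_trans res0; exact: cvg_app.
have [p fp cp] := center_fixpoint \oo _ cvg_id.
exists p => //.
have dot_lt y e : 0 < e -> \forall k \near \oo, dot (x k - p) y < e.
  move=> e0; apply: contrapT => not_near.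
  pose A := [set k | e <= dot (x k - p) y].
  pose G := within A \oo.
  have PG : ProperFilter G.
    split; last exact: within_filter.
    rewrite /G /within/= => G0; apply: not_near.
    apply: filterS G0 => k nA.
    by rewrite ltNge; apply/negP => /nA.
  have G_oo : G --> \oo by exact: cvg_within.
  have [p' fp' cp'] := center_fixpoint G PG G_oo.
  (* Radius at [\oo], limit at [p'], radius along [G]: each is at most the
     next, and the limit at [p] is at most the first. *)
  have cpG : asymptotic_center G x p.
    apply: (asymptotic_center_of_lim _ (dist_lim _ _ _ G_oo fp)).
    apply: le_trans (asymptotic_center_lim_le _ (dist_lim _ _ _ cvg_id fp) cp) _.
    apply: le_trans (asymptotic_radius_le_lim _ (dist_lim _ _ _ cvg_id fp')) _.
    exact: asymptotic_center_lim_le (dist_lim _ _ _ G_oo fp') cp'.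
  have bnd : exists y r, eventually_within G x y r.
    by exists p, (asymptotic_radius G x + 1); apply: cpG; rewrite ltrDl.
  apply: (asymptotic_center_dot hdot PG bnd cpG e0 (y := y)).
  exact: near_withinT.
move=> y; apply/cvgrPdist_le => e e0; near=> k.
rewrite distrC -linearBl/= ler_norml lerNl -linearNr/=.
by apply/andP; split; apply: ltW; near: k; exact: dot_lt.
Unshelve. all: by end_near. Qed.

End WeakConvergence.

(** * Sequences with summable errors *)

Section Summation.
Variable R : realType.
Implicit Types a b P : nat -> R.

Lemma series_le_lim b n :
  (forall k, 0 <= b k) -> cvgn (series b) -> series b n <= limn (series b).
Proof.
move=> b0 cvg_b; apply: nondecreasing_cvgn_le => //.
by apply/nondecreasing_seqP => k; rewrite seriesSr lerDl.
Qed.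

Lemma cvg_series_potential a b P :
  (forall k, 0 <= a k) -> (forall k, 0 <= b k) -> (forall k, 0 <= P k) ->
  cvgn (series b) -> (forall k, a k <= P k - P k.+1 + b k) ->
  cvgn (series a).
Proof.
move=> a0 b0 P0 cvg_b step; apply: nondecreasing_is_cvgn.
  by apply/nondecreasing_seqP => k; rewrite seriesSr lerDl.
exists (P 0%N + limn (series b)) => _ [n _ <-].
suff : series a n <= P 0%N - P n + series b n.
  by have := series_le_lim n b0 cvg_b; have := P0 n; lra.
elim: n => [|n IHn]; first by rewrite /series/= !big_geq// subrr addr0.
by rewrite !seriesSr; have := step n; lra.
Qed.

(** Subtracting the partial sums of the errors leaves a nonincreasing sequence
that is bounded below. *)
Lemma cvg_almost_nonincreasing a b :
  (forall k, 0 <= a k) -> (forall k, 0 <= b k) -> cvgn (series b) ->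
  (forall k, a k.+1 <= a k + b k) -> cvgn a.
Proof.
move=> a0 b0 cvg_b step.
have -> : a = (a - series b) + series b by rewrite subrK.
apply: is_cvgD => //; apply: nonincreasing_is_cvgn.
  apply/nonincreasing_seqP => k.
  rewrite !fctE seriesSr; have := step k; lra.
exists (- limn (series b)) => _ [n _ <-]; rewrite !fctE.
by have := series_le_lim n b0 cvg_b; have := a0 n; lra.
Qed.

End Summation.

(** * The general framework *)

Lemma averaged_nonexpansive (R : realType) (H : completeNormedModType R)
    (T : H -> H) (alpha : R) :
  0 < alpha <= 1 -> averaged alpha T -> nonexpansive T.
Proof.
move=> /andP[alpha0 alpha1] [S neS TE] y z.
have -> : T y - T z = (1 - alpha) *: (y - z) + alpha *: (S y - S z).
  by rewrite !TE !scalerBr opprD addrACA.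
apply: le_trans (ler_normD _ _) _; rewrite !normrZ.
rewrite [X in X * _]ger0_norm ?subr_ge0// [X in _ + X * _]gtr0_norm//.
have := neS y z; rewrite -(ler_pM2l alpha0); lra.
Qed.

Section Framework.
Variables (R : realType) (H : completeNormedModType R) (T : H -> H).
Variables (c0 c1 q sigma : R) (x : nat -> H) (eta rsafe : nat -> R).
Variables (u : nat -> update).
Hypotheses (hc0 : 0 <= c0 < 1) (hc1 : 0 <= c1 < 1) (hq : 0 <= q < 1).
Hypothesis hrun : general_framework T c0 c1 q sigma x eta rsafe u.

Lemma framework_eta_gt0 k : 0 < eta k.
Proof.
have res0 n : 0 < `|residual T (x n)|.
  by rewrite normr_gt0; apply/eqP; exact: framework_continue hrun n.
elim: k => [|k IHk]; first by rewrite (framework_eta0 hrun).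
have := framework_update hrun k; case: (u k) => /=.
- by move=> [_ -> _].
- by move=> [_ -> _ _ _].
- by move=> [_ -> _ _].
Qed.

Lemma framework_rsafe_ge0 k : 0 <= rsafe k.
Proof.
have [q0 _] := andP hq.
elim: k => [|k IHk]; first by rewrite (framework_rsafe0 hrun).
have := framework_update hrun k; case: (u k) => /=.
- by move=> [_ _ ->].
- by move=> [_ _ _ _ ->]; rewrite addr_ge0// exprn_ge0.
- by move=> [_ _ -> _].
Qed.

Definition unguarded_residual (k : nat) : R :=
  if u k is Safeguard then 0 else `|residual T (x k)|.

Lemma unguarded_residual_ge0 k : 0 <= unguarded_residual k.
Proof. by rewrite /unguarded_residual; case: (u k). Qed.

(** The terms of the potential have the factors [c0 / (1 - c0)] and
[1 / (1 - c1)] because [r <= c0 * eta] amounts to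
[r <= c0 / (1 - c0) * (eta - r)], and [rsafe' <= c1 * rsafe + q ^+ k] to
[(1 - c1) * rsafe <= rsafe - rsafe' + q ^+ k]. *)
Lemma unguarded_residual_summable : cvgn (series unguarded_residual).
Proof.
have [c00 c01] := andP hc0; have [c10 c11] := andP hc1; have [q0 q1] := andP hq.
pose A := c0 / (1 - c0); pose B := (1 - c1)^-1.
have A0 : 0 <= A by rewrite divr_ge0// subr_ge0 ltW.
have B0 : 0 <= B by rewrite invr_ge0 subr_ge0 ltW.
have AE : A * (1 - c0) = c0 by rewrite divfK// subr_eq0 gt_eqF.
have BE : B * (1 - c1) = 1 by rewrite mulVf// subr_eq0 gt_eqF.
apply: (@cvg_series_potential _ _ (geometric B q)
  (fun k => A * eta k + B * rsafe k)).
- exact: unguarded_residual_ge0.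
- by move=> k; rewrite /geometric/= mulr_ge0// exprn_ge0.
- move=> k; rewrite addr_ge0// mulr_ge0//; first exact/ltW/framework_eta_gt0.
  exact: framework_rsafe_ge0.
- by apply: is_cvg_geometric_series; rewrite ger0_norm.
move=> k; rewrite /unguarded_residual /geometric/=.
have Bq : 0 <= B * q ^+ k by rewrite mulr_ge0// exprn_ge0.
have := framework_update hrun k; case: (u k) => /=.
- move=> [blind -> ->].
  have : 0 <= (1 - c0)^-1 * (c0 * eta k - `|residual T (x k)|).
    by rewrite mulr_ge0 ?invr_ge0 ?subr_ge0// ltW.
  have -> : (1 - c0)^-1 * (c0 * eta k - `|residual T (x k)|) =
            A * eta k - A * `|residual T (x k)| - `|residual T (x k)|.
    by rewrite /A; field; rewrite subr_eq0 gt_eqF.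
  by lra.
- move=> [_ -> safe contr ->].
  have : 0 <= B * (rsafe k - `|residual T (x k)|) by rewrite mulr_ge0// subr_ge0.
  have : 0 <= B * (c1 * `|residual T (x k)| - `|residual T (x k.+1)|).
    by rewrite mulr_ge0// subr_ge0.
  have : B * (1 - c1) * `|residual T (x k)| = `|residual T (x k)|.
    by rewrite BE mul1r.
  by lra.
- by move=> [_ -> -> _]; lra.
Qed.

Hypotheses (hsigma : 0 < sigma) (neT : nonexpansive T).
Variable D : R.
Hypothesis hD : 0 <= D.
Hypothesis hstep : forall k : nat,
  (iterations u Blind `|` iterations u Educated) k ->
  `|x k.+1 - x k| <= D * `|residual T (x k)|.

Lemma unguarded_step k : u k <> Safeguard ->
  `|x k.+1 - x k| <= D * unguarded_residual k.
Proof.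
move=> nsafe; rewrite /unguarded_residual; have := @hstep k.
rewrite /iterations/=.
by case: (u k) nsafe => // _; apply; [left|right].
Qed.

Lemma dist_fixpoint_step z k : fixpoints T z ->
  `|x k.+1 - z| <= `|x k - z| + D * unguarded_residual k.
Proof.
move=> fz.
have triangle : `|x k.+1 - z| <= `|x k - z| + `|x k.+1 - x k|.
  have -> : x k.+1 - z = (x k.+1 - x k) + (x k - z) by rewrite subrKA.
  by rewrite [leRHS]addrC; exact: ler_normD.
have := framework_update hrun k; have := @unguarded_step k.
rewrite /unguarded_residual; case: (u k) => /= step.
- by move=> _; apply: le_trans triangle _; rewrite lerD2l; exact: step.
- by move=> _; apply: le_trans triangle _; rewrite lerD2l; exact: step.
- move=> [_ _ _ /(_ z fz) descent]; rewrite mulr0 addr0.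
  rewrite -(ler_pXn2r (ltn0Sn 1)) ?nnegrE//; apply: le_trans descent _.
  by rewrite gerBl mulr_ge0 ?sqr_ge0// ltW.
Qed.

Lemma dist_fixpoint_cvg z : fixpoints T z -> cvgn (fun k => `|x k - z|).
Proof.
move=> fz; apply: (@cvg_almost_nonincreasing _ _ (D *: unguarded_residual)) => //.
- by move=> k; rewrite mulr_ge0// unguarded_residual_ge0.
- exact: is_cvg_seriesZ unguarded_residual_summable.
- by move=> k; exact: dist_fixpoint_step.
Qed.

Lemma dist_fixpoint_bounded z : fixpoints T z ->
  exists M, forall k, `|x k - z| <= M.
Proof.
move=> /dist_fixpoint_cvg/cvg_seq_bounded[M [_ bndM]].
exists (M + 1) => k; rewrite -[leLHS]normr_id.
by apply: bndM => //; rewrite ltrDl.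
Qed.

(** A difference of squares is the difference, controlled by
[dist_fixpoint_step], times the sum, which is at most [2 * M]. *)
Lemma sqr_dist_fixpoint_step z M k :
  fixpoints T z -> (forall n, `|x n - z| <= M) ->
  `|x k.+1 - z| ^+ 2 <= `|x k - z| ^+ 2 + 2 * M * D * unguarded_residual k.
Proof.
move=> fz bndM; rewrite -lerBlDl subr_sqr.
have De0 : 0 <= D * unguarded_residual k.
  by rewrite mulr_ge0// unguarded_residual_ge0.
have -> : 2 * M * D * unguarded_residual k =
          (D * unguarded_residual k) * (M + M) by ring.
apply: le_trans (_ : (D * unguarded_residual k) * (`|x k.+1 - z| + `|x k - z|) <= _).
  by rewrite ler_wpM2r ?addr_ge0// lerBlDl; exact: dist_fixpoint_step.
by rewrite ler_wpM2l// lerD.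
Qed.

Lemma framework_quasi_fejer : quasi_fejer x (fixpoints T).
Proof.
move=> z fz; have [M bndM] := dist_fixpoint_bounded fz.
have M0 : 0 <= M by apply: le_trans (bndM 0%N).
have C0 : 0 <= 2 * M * D by rewrite !mulr_ge0.
(* The geometric term only makes the errors positive. *)
exists ((2 * M * D) *: unguarded_residual + geometric 1 2^-1); split.
- move=> k; apply: ltr_wpDl; last by rewrite /geometric/= mul1r exprn_gt0.
  by rewrite mulr_ge0// unguarded_residual_ge0.
- apply: is_cvg_seriesD; first exact: is_cvg_seriesZ unguarded_residual_summable.
  by apply: is_cvg_geometric_series; rewrite ger0_norm// invf_lt1// ltr1n.
- move=> k; apply: le_trans (sqr_dist_fixpoint_step _ fz bndM) _.
  by rewrite lerD2l lerDl /geometric/= mul1r exprn_ge0.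
Qed.

Lemma residual_le_dist z y : fixpoints T z -> `|residual T y| <= 2 * `|y - z|.
Proof.
rewrite /fixpoints/= => fz; have := neT y z; rewrite fz => Tyz.
have -> : residual T y = (y - z) + (z - T y) by rewrite subrKA.
apply: le_trans (ler_normD _ _) _.
by rewrite (distrC z); lra.
Qed.

(** At a safeguarded step [sigma * `|residual T (x k)| ^+ 2] is at most the
decrease of the squared distance to [z]; at the others it is at most
[sigma * (2 * M) * `|residual T (x k)|], a summable term. *)
Lemma sqr_residual_summable : fixpoints T !=set0 ->
  cvgn (series (fun k => `|residual T (x k)| ^+ 2)).
Proof.
move=> [z fz]; have [M bndM] := dist_fixpoint_bounded fz.
have M0 : 0 <= M by apply: le_trans (bndM 0%N).
pose C := (2 * M * D + sigma * (2 * M)) / sigma.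
have C0 : 0 <= C.
  by rewrite divr_ge0 ?addr_ge0 ?mulr_ge0// ltW.
apply: (@cvg_series_potential _ _ (C *: unguarded_residual)
  (fun k => `|x k - z| ^+ 2 / sigma)).
- by move=> k; exact: sqr_ge0.
- by move=> k; rewrite mulr_ge0// unguarded_residual_ge0.
- by move=> k; rewrite divr_ge0 ?sqr_ge0// ltW.
- exact: is_cvg_seriesZ unguarded_residual_summable.
move=> k; rewrite -(ler_pM2l hsigma) fctE.
have -> : sigma * (`|x k - z| ^+ 2 / sigma - `|x k.+1 - z| ^+ 2 / sigma +
              C * unguarded_residual k) =
          `|x k - z| ^+ 2 - `|x k.+1 - z| ^+ 2 +
          (2 * M * D * unguarded_residual k +
           sigma * (2 * M * unguarded_residual k)).
  by rewrite /C; field; rewrite gt_eqF.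
have res_le : `|residual T (x k)| <= 2 * M.
  by apply: le_trans (residual_le_dist (x k) fz) _; rewrite ler_pM2l.
have : sigma * `|residual T (x k)| ^+ 2 <=
    sigma * (2 * M * `|residual T (x k)|).
  by rewrite ler_pM2l// expr2 ler_wpM2r.
have := sqr_dist_fixpoint_step k fz bndM.
have := framework_update hrun k; rewrite /unguarded_residual.
case: (u k) => /=; last by move=> [_ _ _ /(_ z fz)]; lra.
  by move=> _; lra.
by move=> _; lra.
Qed.

Lemma residual_cvg0 : fixpoints T !=set0 ->
  residual T (x k) @[k --> \oo] --> (0 : H).
Proof.
move=> /sqr_residual_summable/cvg_series_cvg_0/cvgr0Pnorm_le sqr0.
apply/cvgr0Pnorm_le => e e0; have := sqr0 _ (exprn_gt0 2 e0).
apply: filterS => k; rewrite ger0_norm ?sqr_ge0//.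
by rewrite ler_pXn2r ?nnegrE// ltW.
Qed.

(** After the last blind step [eta] keeps a positive value, and every later
residual exceeds [c0] times it. *)
Lemma infinite_blind : fixpoints T !=set0 -> 0 < c0 ->
  infinite_set (iterations u Blind).
Proof.
move=> fixT c0_gt0 /finite_seqP[s sE].
pose N := (\max_(i <- s) i).+1.
have not_blind k : (N <= k)%N -> u k <> Blind.
  move=> Nk ukB; have : k \in s by have : iterations u Blind k by []; rewrite sE.
  by move=> ks; have := @leq_bigmax_seq _ s xpredT id k ks isT; rewrite leqNgt Nk.
have eta_const k : (N <= k)%N -> eta k = eta N.
  move=> /subnK <-; elim: (k - N)%N => // n IHn; rewrite addSn -IHn.
  have := framework_update hrun (n + N); have := @not_blind (n + N)%N (leq_addl _ _).
  by case: (u (n + N)%N) => //= _; [move=> [_ ->]|move=> [_ ->]].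
have /cvgrPdist_lt/(_ (c0 * eta N)) := residual_cvg0 fixT.
move=> /(_ (mulr_gt0 c0_gt0 (framework_eta_gt0 N)))[N' _ res_lt].
have := res_lt (maxn N N') (leq_maxr _ _).
rewrite /= sub0r normrN -(eta_const (maxn N N') (leq_maxl _ _)).
move=> lt_eta; have := framework_update hrun (maxn N N').
have := not_blind _ (leq_maxl N N').
case: (u (maxn N N')) => //= _; first by move=> [/ltW]; rewrite leNgt lt_eta.
by move=> [/ltW]; rewrite leNgt lt_eta.
Qed.

End Framework.

Theorem mainTheorem1 (R : realType) (H : completeNormedModType R)
    (dot : {dot H for idfun}) (hdot : induces_norm dot) (hsep : separable H)
    (T : H -> H) (alpha : R) (halpha : 0 < alpha <= 1)
    (hT : averaged alpha T) (hfix : fixpoints T !=set0)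
    (c0 c1 q sigma : R)
    (hc0 : 0 <= c0 < 1) (hc1 : 0 <= c1 < 1) (hq : 0 <= q < 1)
    (hsigma : 0 < sigma)
    (x : nat -> H) (eta rsafe : nat -> R) (u : nat -> update)
    (hrun : general_framework T c0 c1 q sigma x eta rsafe u)
    (D : R) (hD : 0 <= D)
    (hstep : forall k : nat,
       (iterations u Blind `|` iterations u Educated) k ->
       `|x k.+1 - x k| <= D * `|residual T (x k)|) :
  [/\ quasi_fejer x (fixpoints T),
      (residual T (x k) @[k --> \oo] --> (0 : H)) /\
        cvgn (series (fun k : nat => `|residual T (x k)| ^+ 2)),
      exists2 xstar : H, fixpoints T xstar & weakly_cvg dot x xstar &
      0 < c0 -> infinite_set (iterations u Blind)].
Proof.
have neT := averaged_nonexpansive halpha hT.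
have res0 := residual_cvg0 hc0 hc1 hq hrun hsigma neT hD hstep hfix.
split.
- exact: (framework_quasi_fejer hc0 hc1 hq hrun hsigma hD hstep).
- by split=> //; apply: (sqr_residual_summable hc0 hc1 hq hrun hsigma neT hD).
- apply: (weak_cvg_fixpoint hdot neT hfix res0) => z.
  exact: (dist_fixpoint_cvg hc0 hc1 hq hrun hsigma hD hstep).
- exact: (infinite_blind hc0 hc1 hq hrun hsigma neT hD hstep hfix).
Qed.
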